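(* For $n\ge 2$ let $P_n(x,t)=L^{n-2}(1)$, where $L^h$ denotes the composition of $L$ with itself $h$ times ($L^0$ being the identity). Then, for all $n\ge 2$, $$P_n(x,t)=\sum_{k=0}^{n-2}P_n^{(k)}(x)\,t^k .$$
   Context: $L:\mathbf{R}[x,t]\to\mathbf{R}[x,t]$ is the $\mathbf{R}$-linear operator defined on the canonical basis $(x^\alpha t^\beta)_{\alpha,\beta\in\mathbf{N}}$ (with $0\in\mathbf{N}$) by $$L(x^\alpha t^\beta)=x^\alpha\cdot\sum_{i=0}^{\beta+1}x^i t^i .$$ A Dyck path of semilength $n$ is a lattice path from $(0,0)$ to $(2n,0)$ with steps $U=(1,1)$ and $D=(1,-1)$ never going below the $x$-axis. $\mathcal{D}_n$ is the set of Dyck paths of semilength $n$, ordered by $P\le Q$ iff $P$ lies weakly below $Q$; it is a distributive lattice, and the rank of $P\in\mathcal{D}_n$ is $(\alpha(P)-n)/2$, where $\alpha(P)$ is the area of the region between $P$ and the $x$-axis (so the minimum $(UD)^n$ has rank $0$). ECO decomposition: let $n\ge 2$. For $P\in\mathcal{D}_{n-1}$ whose last descent (its final maximal run of $D$ steps) has length $m$, write $P=QD^m$ (so that $Q$ ends with $U$). The sons of $P$ are the $m+1$ Dyck paths $Q\,D^{j}\,UD\,D^{m-j}$, $0\le j\le m$, of semilength $n$ (a peak $UD$ is inserted at each point of the last descent). Each path of $\mathcal{D}_n$ is a son of exactly one path of $\mathcal{D}_{n-1}$, and the sons of a given path form a saturated chain in $\mathcal{D}_n$. The resulting partition of $\mathcal{D}_n$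 into saturated chains (one for each element of $\mathcal{D}_{n-1}$) is the ECO decomposition of $\mathcal{D}_n$. For $n\ge 2$ and $0\le k\le n-2$, $P_n^{(k)}(x)$ is the polynomial in which the coefficient of $x^i$ is the number of chains of cardinality $k+2$ in the ECO decomposition of $\mathcal{D}_n$ whose minimum has rank $i$. *)

(* Defs.v *)
From HB Require Import structures.
From mathcomp Require Import all_boot all_order all_algebra.
From mathcomp Require Import reals.

Set Implicit Arguments.
Unset Strict Implicit.
Unset Printing Implicit Defensive.

Import Order.TTheory GRing.Theory Num.Theory.
Local Open Scope ring_scope.

(* R[x,t] is represented as R[x][t]: t is the outer indeterminate. *)
Definition var_x {R : nzRingType} : {poly {poly R}} := 'X%:P.
Definition var_t {R : nzRingType} : {poly {poly R}} := 'X.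

Definition L_mono {R : nzRingType} (a b : nat) : {poly {poly R}} :=
  var_x ^+ a * \sum_(0 <= i < b.+2) var_x ^+ i * var_t ^+ i.

(* p`_b`_a is the coefficient of x^a t^b in p. *)
Definition L {R : nzRingType} (p : {poly {poly R}}) : {poly {poly R}} :=
  \sum_(b < size p) \sum_(a < size p`_b) (p`_b`_a)%:P%:P * L_mono a b.

Lemma L_widen (R : nzRingType) (p : {poly {poly R}}) (M N : nat) :
  (size p <= M)%N -> (forall b, (size (p`_b)%R <= N)%N) ->
  L p = \sum_(b < M) \sum_(a < N) (p`_b`_a)%:P%:P * L_mono a b.
Proof.
move=> sM sN; rewrite /L.
rewrite (big_ord_widen M (fun b => \sum_(a < size p`_b)
  (p`_b`_a)%:P%:P * L_mono a b)) // big_mkcond /=.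
apply: eq_bigr => b _; case: ltnP => hb.
  rewrite (big_ord_widen N (fun a => (p`_b`_a)%:P%:P * L_mono a b)) //.
  rewrite big_mkcond /=; apply: eq_bigr => a _; case: ltnP => // ha.
  by rewrite (nth_default _ ha) !polyC0 mul0r.
by rewrite big1 // => a _; rewrite (nth_default _ hb) coef0 !polyC0 mul0r.
Qed.

Lemma size_coef_bound (R : nzRingType) (p : {poly {poly R}}) (b : nat) :
  (size (p`_b)%R <= \max_(c < size p) size (p`_c)%R)%N.
Proof.
case: (ltnP b (size p)) => hb; last by rewrite (nth_default _ hb) size_poly0.
exact: (leq_bigmax (Ordinal hb)).
Qed.

Lemma L_linear (R : nzRingType) (c : R) (p q : {poly {poly R}}) :
  L (c%:P%:P * p + q) = c%:P%:P * L p + L q.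
Proof.
pose r := c%:P%:P * p + q.
pose B (s : {poly {poly R}}) := (\max_(i < size s) size (s`_i)%R)%N.
pose M := maxn (size r) (maxn (size p) (size q)).
pose N := maxn (B r) (maxn (B p) (B q)).
have E (s : {poly {poly R}}) : (size s <= M)%N -> (B s <= N)%N ->
  L s = \sum_(b < M) \sum_(a < N) (s`_b`_a)%:P%:P * L_mono a b.
  move=> sM sN; apply: L_widen => // b.
  exact: leq_trans (size_coef_bound s b) sN.
have [h1 h2] : (size r <= M)%N /\ (B r <= N)%N by rewrite !leq_maxl.
have [h3 h4] : (size p <= M)%N /\ (B p <= N)%N.
  by rewrite /M /N !leq_max !leqnn !orbT.
have [h5 h6] : (size q <= M)%N /\ (B q <= N)%N.
  by rewrite /M /N !leq_max !leqnn !orbT.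
rewrite (E r) // (E p) // (E q) // mulr_sumr -big_split /=.
apply: eq_bigr => b _; rewrite mulr_sumr -big_split /=; apply: eq_bigr => a _.
by rewrite coefD coefCM coefD coefCM !polyCD !polyCM mulrDl mulrA.
Qed.

Lemma L_basis (R : nzRingType) (a b : nat) :
  L (var_x ^+ a * var_t ^+ b) =
  var_x ^+ a * \sum_(0 <= i < b.+2) var_x ^+ i * var_t ^+ i :> {poly {poly R}}.
Proof.
have C c : (var_x ^+ a * var_t ^+ b : {poly {poly R}})`_c =
    if c == b then 'X^a else 0.
  rewrite /var_x /var_t -polyC_exp coefCM coefXn.
  by case: eqP => _; rewrite ?mulr1 ?mulr0.
rewrite (@L_widen _ _ b.+1 a.+1); last first.
- by move=> c; rewrite C; case: eqP; rewrite ?size_polyXn ?size_poly0.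
- apply/leq_sizeP => c hc; rewrite C; case: eqP => // e.
  by rewrite e ltnn in hc.
rewrite big_ord_recr /= big1 ?add0r => [|c _]; last first.
  apply: big1 => i _.
  by rewrite C (ltn_eqF (ltn_ord c)) coef0 !polyC0 mul0r.
rewrite big_ord_recr /= big1 ?add0r => [|i _].
  by rewrite C eqxx coefXn eqxx mul1r.
by rewrite C eqxx coefXn (ltn_eqF (ltn_ord i)) !polyC0 mul0r.
Qed.

(* Lattice paths starting at (0,0) are words of steps. *)
Local Notation U := true (only parsing).
Local Notation D := false (only parsing).

Definition height (w : seq bool) (i : nat) : int :=
  (count_mem U (take i w))%:Z - (count_mem D (take i w))%:Z.

Definition is_dyck (w : seq bool) : bool :=
  [forall i : 'I_(size w).+1, 0 <= height w i] && (height w (size w) == 0).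

Definition dyck (n : nat) : {set n.*2.-tuple bool} := [set P : n.*2.-tuple bool | is_dyck P].

Definition below (P Q : seq bool) : bool :=
  [forall i : 'I_(size P).+1, height P i <= height Q i].

(* Each step bounds a trapezoid of width 1 with the x-axis. *)
Definition area (w : seq bool) : rat :=
  \sum_(i < size w) (height w i + height w i.+1)%:~R / 2.

Definition rank (n : nat) (P : n.*2.-tuple bool) : rat := (area P - n%:R) / 2.

Definition last_descent (P : seq bool) : nat := find (pred1 U) (rev P).

Definition son (P : seq bool) (j : nat) : seq bool :=
  let m := last_descent P in
  take (size P - m) P ++ nseq j D ++ [:: U; D] ++ nseq (m - j) D.

Definition sons (n : nat) (P : n.-1.*2.-tuple bool) : {set n.*2.-tuple bool} :=
  [set Q : n.*2.-tuple bool | [exists j : 'I_(last_descent P).+1, tval Q == son P j]].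

Definition eco (n : nat) : {set {set n.*2.-tuple bool}} :=
  [set sons P | P in dyck n.-1].

Definition is_minimum (n : nat) (C : {set n.*2.-tuple bool})
    (P : n.*2.-tuple bool) : bool :=
  (P \in C) && [forall Q in C, below P Q].

Definition nb_chains (n k i : nat) : nat :=
  #|[set C in eco n | (#|C| == k.+2) &&
      [exists P, is_minimum C P && (rank P == i%:R)]]|.

(* The truncation at n ^ 2 loses nothing, see coef_P_nk. *)
Definition P_nk (R : nzRingType) (n k : nat) : {poly R} :=
  \poly_(i < n ^ 2) (nb_chains n k i)%:R.

Lemma coef_P_nk (R : nzRingType) (n k i : nat) :
  (P_nk R n k)`_i = (nb_chains n k i)%:R.
Proof.
rewrite coef_poly; case: ltnP => // hi.
suff -> : nb_chains n k i = 0%N by [].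
apply/eqP; rewrite cards_eq0; apply/eqP/setP => C; rewrite !inE.
apply/negP => /andP[/imsetP[P' P'dyck ->]] /andP[_] /existsP[P].
rewrite /is_minimum inE => /andP[/andP[/existsP[j /eqP Pson] _] /eqP rkP].
have cT l (s : seq bool) : (count_mem U (take l s) <= count_mem U s)%N.
  by rewrite -[in X in (_ <= X)%N](cat_take_drop l s) count_cat leq_addr.
have n_gt0 : (0 < n)%N.
  by rewrite -double_gt0 -(size_tuple P) Pson /son !size_cat /= !addSn !addnS.
have cP' : count_mem U P' = n.-1.
  move: P'dyck; rewrite inE => /andP[_]; rewrite /height take_size subr_eq0.
  rewrite eqz_nat => /eqP cUD.
  have := count_predC (pred1 U) P'; rewrite size_tuple.
  rewrite (_ : count (predC _) _ = count_mem D P'); last first.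
    by apply: eq_count => -[].
  by rewrite -cUD addnn => /double_inj.
have cP : (count_mem U P <= n)%N.
  rewrite Pson /son !count_cat !count_nseq /= !mul0n !add0n !addn0 addn1.
  apply: leq_ltn_trans (cT _ _) _.
  by rewrite cP' prednK.
have hP l : height P l <= n%:Z.
  rewrite /height lerBlDr -PoszD lez_nat (leq_trans _ (leq_addr _ _)) //.
  exact: leq_trans (cT _ _) cP.
have aP : area P <= (2 * n ^ 2)%:R.
  apply: (@le_trans _ _ (\sum_(l < size P) n%:R)); last first.
    by rewrite sumr_const card_ord size_tuple -mulrnA ler_nat -mul2n mulnCA.
  apply: ler_sum => l _; rewrite ler_pdivrMr //.
  rewrite (_ : n%:R * 2 = (n%:Z + n%:Z)%:~R); last first.
    by rewrite intrD mulr_natr mulr2n.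
  by rewrite ler_int lerD.
have : rank P < (n ^ 2)%:R.
  rewrite /rank ltr_pdivrMr // ltrBlDr (le_lt_trans aP) //.
  by rewrite -natrM -natrD ltr_nat mulnC -[X in (X < _)%N]addn0 ltn_add2l.
by rewrite rkP ltr_nat ltnNge hi.
Qed.

(* Main.v *)
Require Import Defs.
From mathcomp Require Import all_boot all_order all_algebra.
From mathcomp Require Import reals.
From mathcomp Require Import zify ring lra.

(* Index the chains of the ECO decomposition of D_n by the paths P of D_(n-1).
   The chain of P has cardinality m + 1, where m is the length of the last
   descent of P, and its minimum P U D has the same rank as P.  So P_n(x,t) is
   the generating function of D_(n-1) in which P has weight
   x^(rank P) t^(m - 1).  Inserting a peak at height i in the last descent,
   0 <= i <= m, raises the rank by i and yields a last descent of length i + 1: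
   the sons of P have total weight x^(rank P) (1 + x t + ... + x^m t^m), which
   is the image under L of the weight of P.  Every Dyck path has a unique
   father, so L maps the generating function of D_(n-1) to that of D_n. *)

Import Order.TTheory GRing.Theory Num.Theory.
Local Open Scope ring_scope.

(** * Heights of words and the Dyck condition *)

Definition final_height (w : seq bool) : int := height w (size w).

Lemma final_heightE w :
  final_height w = (count_mem true w)%:Z - (count_mem false w)%:Z.
Proof. by rewrite /final_height /height take_size. Qed.

Lemma height_take w i : height w i = final_height (take i w).
Proof. by rewrite final_heightE. Qed.

Lemma final_height_count w :
  final_height w = (count_mem true w).*2%:Z - (size w)%:Z.
Proof.
rewrite final_heightE -(count_predC (pred1 true) w).
have -> : count (predC (pred1 true)) w = count_mem false w.
  by apply: eq_count => -[].
lia.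
Qed.

Lemma height_cat u v i : (i <= size u)%N -> height (u ++ v) i = height u i.
Proof. by move=> hi; rewrite /height takel_cat. Qed.

Lemma final_height_cat u v :
  final_height (u ++ v) = final_height u + final_height v.
Proof. rewrite !final_heightE !count_cat; lia. Qed.

Lemma final_height_nseq a : final_height (nseq a false) = - a%:Z.
Proof. rewrite final_heightE !count_nseq /=; lia. Qed.

Lemma final_height_rcons w b :
  final_height (rcons w b) = final_height w + (if b then 1 else -1).
Proof. by rewrite -cats1 final_height_cat; case: b. Qed.

Definition nonneg (w : seq bool) : bool :=
  [forall i : 'I_(size w).+1, 0 <= height w i].

Lemma nonnegP w :
  reflect (forall i, (i <= size w)%N -> 0 <= height w i) (nonneg w).
Proof.
apply: (iffP forallP) => [h i hi|h i].
  exact: (h (Ordinal (hi : (i < (size w).+1)%N))).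
by apply: h; rewrite -ltnS.
Qed.

Lemma nonneg_rcons w b :
  nonneg (rcons w b) = nonneg w && (0 <= final_height (rcons w b)).
Proof.
apply/nonnegP/andP => [h|[/nonnegP h hf] i].
  split; last exact: h.
  apply/nonnegP => i hi; rewrite -(height_cat w [:: b]) // cats1.
  by apply: h; rewrite size_rcons ltnW.
rewrite leq_eqVlt => /orP[/eqP->//|]; rewrite size_rcons ltnS => hi.
by rewrite -cats1 height_cat // h.
Qed.

Lemma nonneg_rcons_up w : nonneg (rcons w true) = nonneg w.
Proof.
rewrite nonneg_rcons final_height_rcons; case: (boolP (nonneg w)) => //= /nonnegP h.
have := h _ (leqnn _); rewrite -/(final_height w); lia.
Qed.

(** Heights decrease along the descent, so its endpoint is the only one to check. *)
Lemma nonneg_descent w a :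
  nonneg (w ++ nseq a false) = nonneg w && (a%:Z <= final_height w).
Proof.
elim: a => [|a IH].
  rewrite cats0; case: (boolP (nonneg w)) => //= /nonnegP h.
  by rewrite [RHS]h.
rewrite -addn1 nseqD catA cats1 nonneg_rcons IH final_height_rcons.
rewrite final_height_cat final_height_nseq; case: (nonneg w) => //=; lia.
Qed.

Lemma is_dyckE w : is_dyck w = nonneg w && (final_height w == 0).
Proof. by []. Qed.

Lemma is_dyck_descent q a :
  is_dyck (q ++ nseq a false) = nonneg q && (final_height q == a%:Z).
Proof.
rewrite is_dyckE nonneg_descent final_height_cat final_height_nseq subr_eq0.
by case: (nonneg q) => //=; lia.
Qed.

(** By [is_dyck_descent], both sides ask that [q] be nonnegative and end at height [j + b]; the up
    step cannot create a negative height. *)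
Lemma is_dyck_son q j b :
  is_dyck (q ++ nseq j false ++ true :: nseq b.+1 false) =
  is_dyck (q ++ nseq (j + b) false).
Proof.
have -> : q ++ nseq j false ++ true :: nseq b.+1 false =
  rcons (q ++ nseq j false) true ++ nseq b.+1 false.
  by rewrite cat_rcons catA.
rewrite !is_dyck_descent nonneg_rcons_up nonneg_descent final_height_rcons.
rewrite final_height_cat final_height_nseq.
by case: (nonneg q) => //=; lia.
Qed.

(** * Last descents, sons and fathers *)

Lemma descent_split w : exists q a, w = q ++ nseq a false /\ last true q.
Proof.
(* The default [true] of [last] admits the empty [q]; any other [q] ends with an up step. *)
elim/last_ind: w => [|w [] [q [a [-> lq]]]]; first by exists [::], 0%N.
- by exists (rcons (q ++ nseq a false) true), 0%N; rewrite cats0 last_rcons.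
- exists q, a.+1; split=> //.
  by rewrite -addn1 nseqD catA cats1.
Qed.

Lemma last_descent_cat q a : last true q -> last_descent (q ++ nseq a false) = a.
Proof.
rewrite /last_descent rev_cat rev_nseq find_cat has_nseq andbF size_nseq.
by case/lastP: q => [|q b]; rewrite ?addn0 // last_rcons rev_rcons /= => ->; rewrite addn0.
Qed.

Lemma son_cat q a j : last true q -> (j <= a)%N ->
  son (q ++ nseq a false) j = q ++ nseq j false ++ true :: nseq (a - j).+1 false.
Proof.
move=> lq hj; rewrite /son last_descent_cat // size_cat size_nseq addnK.
by rewrite take_size_cat.
Qed.

Lemma size_son w j : (j <= last_descent w)%N -> size (son w j) = (size w).+2.
Proof.
have [q [a [-> lq]]] := descent_split w; rewrite last_descent_cat // => hj.
by rewrite son_cat // !(size_cat, size_nseq) /= size_nseq; lia.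
Qed.

Lemma last_descent_son w j : (j <= last_descent w)%N ->
  last_descent (son w j) = (last_descent w - j).+1.
Proof.
have [q [a [-> lq]]] := descent_split w; rewrite last_descent_cat // => hj.
rewrite son_cat // -cat_rcons catA last_descent_cat //.
by rewrite last_cat last_rcons.
Qed.

(** Removes the last peak: the last up step and one of the down steps after it. *)
Definition father (w : seq bool) : seq bool :=
  take (size w - (last_descent w).+1) w ++ nseq (last_descent w).-1 false.

Lemma fatherK w j : (j <= last_descent w)%N -> father (son w j) = w.
Proof.
have [q [a [-> lq]]] := descent_split w; move=> hj.
rewrite /father last_descent_son // size_son //.
move: hj; rewrite last_descent_cat // => hj.
rewrite son_cat // size_cat size_nseq catA take_size_cat; last first.
  by rewrite size_cat size_nseq; lia.
by rewrite -catA -nseqD subnKC.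
Qed.

Lemma son_inj w : {in [pred j | j <= last_descent w]%N &, injective (son w)}.
Proof.
move=> i j /= hi hj e; have := last_descent_son w i hi.
rewrite e last_descent_son //; rewrite !inE in hi hj; lia.
Qed.

Lemma dyck_son w j : (j <= last_descent w)%N -> is_dyck (son w j) = is_dyck w.
Proof.
have [q [a [-> lq]]] := descent_split w; rewrite last_descent_cat // => hj.
by rewrite son_cat // is_dyck_son subnKC.
Qed.

(** The witness is the word with its last peak removed. The index is the one forced by
    [last_descent_son]. *)
Lemma dyck_is_son w : is_dyck w -> w != [::] ->
  exists2 v, w = son v (last_descent v - (last_descent w).-1) &
  (last_descent v - (last_descent w).-1 <= last_descent v)%N.
Proof.
have [q [a [-> lq]]] := descent_split w.
rewrite is_dyck_descent => /andP[nq /eqP fq].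
case/lastP: q lq nq fq => [|q c].
  by case: a.
rewrite last_rcons => hc; rewrite {c}hc nonneg_rcons_up final_height_rcons => /nonnegP nq fq _.
have hq : 0 <= final_height q by exact: nq.
(* A Dyck word cannot end with an up step, which would start at height -1. *)
case: a fq => [|a] fq; first by lia.
(* The [j] down steps before the removed peak merge with the [a] remaining after it. *)
have [r [j [Eq lr]]] := descent_split q.
exists (r ++ nseq (j + a) false); rewrite !last_descent_cat ?last_rcons //=; last first.
  by rewrite leq_subr.
rewrite addnK son_cat ?leq_addr // Eq cat_rcons -catA.
by rewrite addKn.
Qed.

(** * Enumeration of Dyck words along the generating tree *)

Fixpoint dyck_words (n : nat) : seq (seq bool) :=
  if n is m.+1 then
    [seq son w j | w <- dyck_words m, j <- iota 0 (last_descent w).+1]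
  else [:: [::]].

Lemma mem_dyck_words n w :
  (w \in dyck_words n) = is_dyck w && (size w == n.*2).
Proof.
elim: n w => [|n IH] w.
  rewrite inE size_eq0; case: eqP => [->|]; rewrite ?andbF //.
  by apply/esym/andP; split=> //; apply/andP; split=> //; apply/nonnegP => -[].
apply/allpairsPdep/andP => [[v [j [hv]]]|[dw /eqP sw]].
  rewrite mem_iota add0n ltnS /= => hj ->.
  move: hv; rewrite IH => /andP[dv /eqP sv].
  by rewrite dyck_son // size_son // sv.
have [|v Ew hv] := dyck_is_son w dw; first by rewrite -size_eq0 sw.
exists v, (last_descent v - (last_descent w).-1)%N; split=> //.
  rewrite IH -(dyck_son _ _ hv) -Ew dw /=.
  by have := size_son _ _ hv; rewrite -Ew sw; lia.
by rewrite mem_iota add0n ltnS.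
Qed.

(** [father] recovers the word of which an entry is a son, and the length of the last descent then
    recovers the insertion point. *)
Lemma uniq_dyck_words n : uniq (dyck_words n).
Proof.
elim: n => [//|n IH] /=.
apply: (@allpairs_uniq_dep _ (fun=> nat) _ son _
  (fun w => iota 0 (last_descent w).+1)) => //.
  by move=> *; exact: iota_uniq.
move=> _ _ /allpairsPdep[v [j [_ hj ->]]] /allpairsPdep[v' [j' [_ hj' ->]]] /= e.
rewrite !mem_iota !add0n !ltnS /= in hj hj'.
have ev : v = v' by rewrite -(fatherK _ _ hj) e fatherK.
by subst v'; rewrite (son_inj _ _ _ hj hj' e).
Qed.

(** Ensures that the exponent [(last_descent w).-1] of [t] is a true subtraction. *)
Lemma last_descent_gt0 n w : w \in dyck_words n.+1 -> (0 < last_descent w)%N.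
Proof.
move=> /allpairsPdep[v [j [_]]]; rewrite mem_iota add0n ltnS => hj ->.
by rewrite last_descent_son.
Qed.

(** Each insertion lengthens the last descent by at most one. This bounds the degree in [t]. *)
Lemma last_descent_le n w : w \in dyck_words n -> (last_descent w <= n)%N.
Proof.
elim: n w => [|n IH] w; first by rewrite inE => /eqP->.
move=> /allpairsPdep[v [j [/IH hv]]]; rewrite mem_iota add0n ltnS => hj ->.
by rewrite last_descent_son // ltnS (leq_trans (leq_subr _ _)).
Qed.

(** * Area and rank *)

Lemma area_rcons w b : area (rcons w b) =
  area w + (final_height w)%:~R + (if b then 1 else -1) / 2.
Proof.
rewrite /area size_rcons big_ord_recr /= -[RHS]addrA; congr (_ + _).
  by apply: eq_bigr => i _; rewrite -cats1 !height_cat // ltnW.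
rewrite -cats1 height_cat // cats1.
have -> : height (rcons w b) (size w).+1 = final_height (rcons w b).
  by rewrite /final_height size_rcons.
rewrite final_height_rcons -/(final_height w).
by case: b; rewrite !intrD /=; lra.
Qed.

(** From height h, the descent bounds a trapezoid of width [a] and mean height h - a/2. *)
Lemma area_descent w a : area (w ++ nseq a false) =
  area w + a%:R * (final_height w)%:~R - a%:R ^+ 2 / 2.
Proof.
elim: a => [|a IH]; first by rewrite cats0; lra.
rewrite -addn1 nseqD catA cats1 area_rcons IH.
rewrite final_height_cat final_height_nseq intrD natrD mulrNz.
have -> : (a%:Z%:~R : rat) = a%:R by [].
by field.
Qed.

(** The insertion point has height b = [last_descent w - j], and the new peak stands on a strip of
    width 2 and height b: it adds area 2b + 1. *)
Lemma area_son w j : is_dyck w -> (j <= last_descent w)%N ->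
  area (son w j) = area w + (2 * (last_descent w - j) + 1)%:R.
Proof.
have [q [a [-> lq]]] := descent_split w; rewrite last_descent_cat //.
rewrite is_dyck_descent => /andP[_ /eqP fq] hj; rewrite son_cat //.
have [b E] : exists b, a = (j + b)%N by exists (a - j)%N; rewrite subnKC.
rewrite {a hj}E in fq *; rewrite addKn -cat_rcons catA -rcons_cat.
rewrite area_descent area_rcons final_height_rcons area_descent.
rewrite final_height_cat final_height_nseq area_descent fq.
by rewrite PoszD !intrD mulrNz -!pmulrn mul2n -addnn -addn1 !natrD /=; field.
Qed.

Definition list_rank (w : seq bool) : rat := (area w - (size w)%:R / 2) / 2.

Lemma list_rank_nil : list_rank [::] = 0.
Proof. by rewrite /list_rank /area big_ord0 /= mulr0n; lra. Qed.

Lemma rankE n (P : n.*2.-tuple bool) : rank P = list_rank P.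
Proof.
have e : n%:R = (n.*2)%:R / 2 :> rat by rewrite -muln2 natrM mulfK.
by rewrite /rank /list_rank size_tuple -e.
Qed.

Lemma list_rank_son w j : is_dyck w -> (j <= last_descent w)%N ->
  list_rank (son w j) = list_rank w + (last_descent w - j)%:R.
Proof.
move=> dw hj; rewrite /list_rank area_son // size_son // -addn2 mul2n -addnn !natrD.
by field.
Qed.

(* Junk when [list_rank w] is not a natural number, see [nat_rankE]. *)
Definition nat_rank (w : seq bool) : nat := Num.truncn (list_rank w).

(** The empty word has rank 0 and each insertion adds a natural number. *)
Lemma nat_rankE n w : w \in dyck_words n -> list_rank w = (nat_rank w)%:R.
Proof.
suff : w \in dyck_words n -> exists r : nat, list_rank w = r%:R.
  by move=> h /h [r e]; rewrite /nat_rank e natrK.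
elim: n w => [|n IH] w.
  rewrite inE => /eqP->; exists 0%N; exact: list_rank_nil.
move=> /allpairsPdep[v [j [hv]]]; rewrite mem_iota add0n ltnS => hj ->.
have [r e] := IH _ hv; move: hv; rewrite mem_dyck_words => /andP[dv _].
by exists (r + (last_descent v - j))%N; rewrite list_rank_son // e natrD.
Qed.

Lemma nat_rank_son n w j : w \in dyck_words n -> (j <= last_descent w)%N ->
  nat_rank (son w j) = (nat_rank w + (last_descent w - j))%N.
Proof.
move=> hw hj; have := hw; rewrite mem_dyck_words => /andP[dw _].
by rewrite /nat_rank list_rank_son // (nat_rankE _ _ hw) -natrD !natrK.
Qed.

(** * Order and minima *)

Lemma below_count u v : size u = size v ->
  (forall i, count_mem true (take i u) <= count_mem true (take i v))%N ->
  below u v.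
Proof.
(* At equal length, the height grows with the number of up steps. *)
move=> e h; apply/forallP => -[i hi] /=; rewrite !height_take !final_height_count.
have es : size (take i u) = size (take i v) by rewrite !size_take e.
by rewrite es lerD2r lez_nat leq_double h.
Qed.

(** After a common prefix the two sons read D^b U D and U D^(b+1): the first has a single up step,
    and the second starts with one. *)
Lemma below_son w j : (j <= last_descent w)%N ->
  below (son w (last_descent w)) (son w j).
Proof.
move=> hj; apply: below_count => [|i]; first by rewrite !size_son.
have [q [a [Ew lq]]] := descent_split w; move: hj.
rewrite Ew last_descent_cat // => hj; rewrite !son_cat // subnn.
have [b ->] : exists b, a = (j + b)%N by exists (a - j)%N; rewrite subnKC.
rewrite addKn nseqD !catA -[(_ ++ nseq b _) ++ _]catA.
move: (q ++ nseq j false) => u; rewrite !(take_cat _ u).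
case: ltnP => // hi; rewrite !count_cat leq_add2l.
case: (i - size u)%N => [|l]; first by rewrite !take0.
rewrite /= (leq_trans _ (leq_addr _ _)) //.
set s := nseq b false ++ [:: true; false].
apply: (@leq_trans (count_mem true s)).
  by rewrite -[in leqRHS](cat_take_drop l.+1 s) count_cat leq_addr.
by rewrite count_cat count_nseq.
Qed.

Lemma le_area u v : size u = size v -> below u v -> area u <= area v.
Proof.
move=> e /forallP h; rewrite /area -e; apply: ler_sum => i _.
rewrite ler_pM2r // ler_int lerD //; first exact: (h (widen_ord (leqnSn _) i)).
exact: (h (lift ord0 i)).
Qed.

(** Two minima lie below each other, hence bound equal areas. So the minimum that [nb_chains] merely
    asserts to exist has the rank computed in [minimum_sons]. *)
Lemma list_rank_minimum n (C : {set n.*2.-tuple bool}) P Q :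
  is_minimum C P -> is_minimum C Q -> list_rank P = list_rank Q.
Proof.
move=> /andP[PC /forall_inP hP] /andP[QC /forall_inP hQ].
rewrite /list_rank !size_tuple; congr ((_ - _) / _); apply/eqP; rewrite eq_le.
by rewrite !le_area ?size_tuple ?hP ?hQ.
Qed.

(** * Counting the chains of the ECO decomposition *)

Lemma card_tuple_mem (T : finType) n (s : seq (seq T)) : uniq s ->
  {in s, forall w, size w = n} ->
  #|[set P : n.-tuple T | tval P \in s]| = size s.
Proof.
move=> us hs; rewrite cardE -(size_map val); apply/perm_size.
apply: uniq_perm => // [|w]; first by rewrite (map_inj_uniq val_inj) enum_uniq.
apply/mapP/idP => [[P]|hw]; first by rewrite mem_enum inE => ? ->.
have sw := introT eqP (hs _ hw).
by exists (Tuple sw) => //; rewrite mem_enum inE.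
Qed.

Section Sons.
Variables (n : nat) (n_gt0 : (0 < n)%N).
Implicit Types P : n.-1.*2.-tuple bool.

Lemma size_son_tuple P j : (j <= last_descent P)%N -> size (son P j) = n.*2.
Proof. by move=> hj; rewrite size_son // size_tuple -doubleS prednK. Qed.

Lemma mem_sons P (Q : n.*2.-tuple bool) :
  reflect (exists2 j, (j <= last_descent P)%N & tval Q = son P j) (Q \in sons P).
Proof.
rewrite inE; apply: (iffP existsP) => [[j /eqP e]|[j hj e]].
  by exists j => //; rewrite -ltnS.
by exists (Ordinal (hj : (j < (last_descent P).+1)%N)); rewrite e.
Qed.

Lemma son_in_sons P j : (j <= last_descent P)%N ->
  exists2 Q : n.*2.-tuple bool, Q \in sons P & tval Q = son P j.
Proof.
move=> hj; exists (Tuple (introT eqP (size_son_tuple P j hj))) => //.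
by apply/mem_sons; exists j.
Qed.

Lemma card_sons P : #|sons P| = (last_descent P).+1.
Proof.
pose s := [seq son P j | j <- iota 0 (last_descent P).+1].
rewrite -[RHS](size_iota 0) -(size_map (son P)) -/s -(@card_tuple_mem _ n.*2).
- apply: eq_card => Q; rewrite [RHS]inE; apply/mem_sons/mapP => -[j hj e].
    by exists j => //; rewrite mem_iota add0n ltnS.
  by exists j => //; move: hj; rewrite mem_iota add0n ltnS.
- rewrite map_inj_in_uniq ?iota_uniq // => i j.
  by rewrite !mem_iota !add0n !ltnS => hi hj; apply: son_inj.
- move=> _ /mapP[j hj ->]; apply: size_son_tuple.
  by move: hj; rewrite mem_iota add0n ltnS.
Qed.

(** A chain contains the son of index 0, from which [father] recovers the path. Chains can thus be
    counted by their fathers, although [eco] is a set of sets. *)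
Lemma sons_inj : injective (@sons n).
Proof.
move=> P P' e; have [Q hQ EQ] := son_in_sons P 0 (leq0n _).
move: hQ; rewrite e => /mem_sons[j hj]; rewrite EQ => E.
by apply: val_inj; rewrite /= -(fatherK _ _ (leq0n (last_descent P))) E fatherK.
Qed.

Lemma minimum_sons P : is_dyck P ->
  exists2 M : n.*2.-tuple bool, is_minimum (sons P) M & list_rank M = list_rank P.
Proof.
move=> dP; have [M hM EM] := son_in_sons P _ (leqnn _).
exists M; last by rewrite EM list_rank_son // subnn addr0.
rewrite /is_minimum hM; apply/forall_inP => Q /mem_sons[j hj ->].
by rewrite EM below_son.
Qed.

Lemma nb_chains_count k i : nb_chains n k i =
  count (fun w => (last_descent w == k.+1) && (nat_rank w == i)) (dyck_words n.-1).
Proof.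
rewrite -size_filter -(@card_tuple_mem _ n.-1.*2); first last.
- by move=> w; rewrite mem_filter mem_dyck_words => /and3P[_ _ /eqP].
- exact/filter_uniq/uniq_dyck_words.
rewrite -(card_imset _ sons_inj); apply: eq_card => C; rewrite inE.
apply/andP/imsetP => [[/imsetP[P]]|[P]].
  rewrite inE => dP -> /andP[hc /existsP[M /andP[hM hr]]]; exists P => //.
  have dw : tval P \in dyck_words n.-1 by rewrite mem_dyck_words dP size_tuple eqxx.
  rewrite inE mem_filter dw andbT -eqSS -card_sons hc /=.
  have [M' hM' e] := minimum_sons P dP.
  rewrite -(@eqr_nat rat) -(nat_rankE _ _ dw) -e.
  by rewrite -(list_rank_minimum _ _ _ _ hM hM') -rankE.
rewrite inE mem_filter => /andP[/andP[/eqP hl /eqP hr] dw] ->.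
have dP : is_dyck P by move: dw; rewrite mem_dyck_words => /andP[].
split; first by apply/imsetP; exists P; rewrite // inE.
rewrite card_sons hl eqxx; have [M hM e] := minimum_sons P dP.
by apply/existsP; exists M; rewrite hM rankE e (nat_rankE _ _ dw) hr /=.
Qed.

End Sons.

(** * The operator [L] on the generating function *)

Lemma L0 (R : nzRingType) : L (0 : {poly {poly R}}) = 0.
Proof. by rewrite /L size_poly0 big_ord0. Qed.

Lemma L_sum (R : nzRingType) (I : Type) (s : seq I) (F : I -> {poly {poly R}}) :
  L (\sum_(i <- s) F i) = \sum_(i <- s) L (F i).
Proof.
apply: (big_morph _ _ (L0 R)) => p q.
by have := L_linear 1 p q; rewrite !mul1r.
Qed.

Lemma iter_L (R : nzRingType) m : iter m L (1 : {poly {poly R}}) =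
  \sum_(w <- dyck_words m.+1) var_x ^+ nat_rank w * var_t ^+ (last_descent w).-1.
Proof.
elim: m => [|m IH].
  have -> : dyck_words 1 = [:: [:: true; false]] by [].
  rewrite big_seq1 (nat_rank_son 0 [::] 0) // /nat_rank list_rank_nil truncn0.
  by rewrite !expr0 mulr1.
rewrite iterS IH L_sum [RHS](@big_allpairs_dep) /=.
apply: eq_big_seq => w hw; rewrite L_basis mulr_sumr.
rewrite prednK ?(last_descent_gt0 _ _ hw) //.
(* The sum is reversed because [son] indexes insertion points from the top of the descent, while the
   exponents in [L] are their heights. *)
rewrite big_nat_rev /= add0n -/(index_iota 0 _) big_seq [RHS]big_seq.
rewrite /index_iota subn0; apply: eq_bigr => j.
rewrite mem_iota add0n ltnS /= => hj.
by rewrite (nat_rank_son m.+1 _ _ hw) // last_descent_son // subSS mulrA -exprD.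
Qed.

Theorem proposition3p4 (R : realType) (n : nat) (hn : (2 <= n)%N) :
  iter (n - 2) L (1 : {poly {poly R}}) =
  \sum_(0 <= k < (n - 2).+1) (P_nk R n k)%:P * var_t ^+ k.
Proof.
have n_gt0 : (0 < n)%N by exact: ltnW.
have En : (n - 2).+1 = n.-1 by case: n hn {n_gt0} => [|[|n]] //= _; rewrite subn2.
rewrite iter_L En; apply/polyP => k; apply/polyP => i.
rewrite !coef_sum.
(* A word contributes 1 to the coefficient of x^i t^k exactly when its rank is [i] and its last
   descent has length [k.+1]. *)
have -> : \sum_(w <- dyck_words n.-1)
    (var_x ^+ nat_rank w * var_t ^+ (last_descent w).-1 : {poly {poly R}})`_k`_i
  = (nb_chains n k i)%:R.
  rewrite nb_chains_count // -sum1_count natr_sum [RHS]big_mkcond.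
  apply: eq_big_seq => w hw.
  have lw : (0 < last_descent w)%N by move: hw; rewrite -En => /last_descent_gt0.
  rewrite -polyC_exp coefCM coefXn -{2}(prednK lw) eqSS eq_sym.
  case: eqP => _; rewrite ?mulr1 ?mulr0 ?coef0 //= coefXn eq_sym.
  by case: eqP.
under eq_bigr => b _ do rewrite coefCM coefXn.
case: (ltnP k n.-1) => hk.
  rewrite (bigD1_seq k) ?mem_index_iota ?iota_uniq //= eqxx mulr1 big1 ?addr0.
    by rewrite coef_P_nk.
  by move=> b /negPf; rewrite eq_sym => ->; rewrite mulr0 coef0.
(* Beyond the range of the sum there is no chain: a last descent of length [k.+1] would exceed the
   semilength [n.-1]. *)
rewrite big_nat big1 => [|b /andP[_ hb]]; last first.
  by rewrite gtn_eqF ?mulr0 ?coef0 // (leq_trans hb).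
rewrite nb_chains_count // (_ : count _ _ = 0%N) //.
apply/eqP; rewrite -leqn0 leqNgt -has_count; apply/hasPn => w hw.
apply/negP => /andP[/eqP lw _]; have := last_descent_le _ _ hw.
by rewrite lw ltnNge hk.
Qed.
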